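(* Let $R$ be a binary relation on a lattice $L$. Then the following are equivalent: (i) $R$ is a reflexive weak ordered relation; (ii) $R$ is a reflexive compatible relation on $L$ which satisfies ${\leq}\circ R\circ{\leq}=R$.
   Context: Binary relations are composed by: $(x,y)\in R\circ S$ iff there is $z$ with $(x,z)\in R$ and $(z,y)\in S$; $\leq$ is the order of $L$. A binary relation on a lattice $L$ is compatible if it is a sublattice of the direct product $L^2=L\times L$. A binary relation $R$ on a lattice $L$ is a weak ordered relation if: (1) for any $u,x,y,z\in L$, $u\leq x$, $(x,y)\in R$ and $y\leq z$ imply $(u,z)\in R$; (2) for any $t\in L$ and any nonempty finite $A\subseteq L$, if $(a,t)\in R$ for each $a\in A$ then $\left(\bigvee A,t\right)\in R$; (3) for any $z\in L$ and any nonempty finite $A\subseteq L$, if $(z,a)\in R$ for each $a\in A$ then $\left(z,\bigwedge A\right)\in R$. *)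

(* Defs.v *)
From mathcomp Require Import all_boot all_order.
From mathcomp Require Export mathcomp_extra boolp classical_sets functions.
From mathcomp Require Export cardinality.

Set Implicit Arguments.
Unset Strict Implicit.
Unset Printing Implicit Defensive.

Import Order.TTheory.
Local Open Scope classical_set_scope.

Section BinaryRelations.
Context {d : Order.disp_t} {L : latticeType d}.
Implicit Types (R S : set (L * L)) (A : set L).

Definition leq_rel : set (L * L) := [set p | (p.1 <= p.2)%O].

(* The relation [R o S] relating [x] to [y] when [R (x, z)] and [S (z, y)] for
   some [z]; the library's [S \; R] takes its arguments in functional order. *)
Definition relcomp R S : set (L * L) := (S \; R)%relation.

Definition reflexive_rel R := forall x, R (x, x).

(* [L *p L] is the direct product [L * L] with its componentwise lattice
   structure. *)
Definition compatible R :=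
  let S : {pred L *p L} := [in R] in
  Order.ClosedPredicates.meet_closed S /\ Order.ClosedPredicates.join_closed S.

(* The first argument of [supremum] and [infimum] is the value returned when
   there is no bound; it plays no role for a nonempty finite set, by
   [finite_supremumP] and [finite_infimumP] below. *)
Definition weak_ordered R :=
  [/\ forall u x y z, (u <= x)%O -> R (x, y) -> (y <= z)%O -> R (u, z),
      forall t A, finite_set A -> A !=set0 ->
        (forall a, A a -> R (a, t)) -> R (supremum t A, t)
    & forall z A, finite_set A -> A !=set0 ->
        (forall a, A a -> R (z, a)) -> R (z, infimum z A)].

Lemma finite_supremumP (x0 : L) A : finite_set A -> A !=set0 ->
  supremums A (supremum x0 A).
Proof.
move=> /finite_seqP[s ->] [x xs]; rewrite /supremum ifF; last first.
  by apply/eqP => s0; move: xs; rewrite s0.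
suff [m mP] : exists m, supremums [set` s] m by exact: (xgetPex x0 (ex_intro _ m mP)).
case: s xs => [//|y s _]; elim: s y => [|z s IH] y.
  by exists y; rewrite set_cons1 supremums1.
have [m [mub mlub]] := IH z; exists (y `|` m)%O; split.
  move=> w /=; rewrite inE => /orP[/eqP->|ws]; first exact: leUl.
  by apply: le_trans (leUr m y); exact: mub.
move=> b bub; rewrite leUx; apply/andP; split.
  by apply: bub; rewrite /= mem_head.
by apply: mlub => w ws; apply: bub; rewrite /= inE; apply/orP; right.
Qed.

Lemma finite_infimumP (x0 : L) A : finite_set A -> A !=set0 ->
  infimums A (infimum x0 A).
Proof.
move=> /finite_seqP[s ->] [x xs]; rewrite /infimum ifF; last first.
  by apply/eqP => s0; move: xs; rewrite s0.
suff [m mP] : exists m, infimums [set` s] m by exact: (xgetPex x0 (ex_intro _ m mP)).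
case: s xs => [//|y s _]; elim: s y => [|z s IH] y.
  by exists y; rewrite set_cons1 infimums1.
have [m [mlb mglb]] := IH z; exists (y `&` m)%O; split.
  move=> w /=; rewrite inE => /orP[/eqP->|ws]; first exact: leIl.
  by apply: le_trans (leIr m y) _; exact: mlb.
move=> b blb; rewrite lexI; apply/andP; split.
  by apply: blb; rewrite /= mem_head.
by apply: mglb => w ws; apply: blb; rewrite /= inE; apply/orP; right.
Qed.

End BinaryRelations.

(* Main.v *)
Require Import Defs.
From mathcomp Require Import all_boot all_order.

Import Order.TTheory.

(** By induction, closure under nonempty finite joins or meets amounts to closure under binary ones,
    so [weak_orderedP] turns a weak ordered relation into one with condition (1), binary joins in
    the first coordinate and binary meets in the second. Condition (1) is the equation on [relcomp]
    ([relcomp_leqP]). Given (1), two pairs of [R] can be brought to a common first coordinate by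
    lowering, or to a common second one by raising, which makes the one-sided operations yield the
    componentwise ones. Conversely, idempotence makes the one-sided operations instances of the
    componentwise ones. *)

Section FiniteBounds.
Set Implicit Arguments.
Local Open Scope classical_set_scope.
Context {d : Order.disp_t} {L : latticeType d}.
Implicit Types (x y b m w : L) (A : set L) (P : L -> Prop).

(** [supremum] is a choice among least upper bounds; antisymmetry makes it computable from any
    witness. *)
Lemma supremumE x0 A m : finite_set A -> A !=set0 -> supremums A m ->
  supremum x0 A = m.
Proof.
by move=> fA A0 Am; apply: is_subset1_supremums Am; exact: finite_supremumP.
Qed.

Lemma infimumE x0 A m : finite_set A -> A !=set0 -> infimums A m ->
  infimum x0 A = m.
Proof.
by move=> fA A0 Am; apply: is_subset1_infimums Am; exact: finite_infimumP.
Qed.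

Lemma supremum_set2 x0 x y : supremum x0 [set x; y] = (x `|` y)%O.
Proof.
apply: supremumE; [exact: finite_set2 | by exists x; left |].
split=> [w [->|->]|b bub]; [exact: leUl | exact: leUr |].
by rewrite leUx !bub //; [right | left].
Qed.

Lemma infimum_set2 x0 x y : infimum x0 [set x; y] = (x `&` y)%O.
Proof.
apply: infimumE; [exact: finite_set2 | by exists x; left |].
split=> [w [->|->]|b blb]; [exact: leIl | exact: leIr |].
by rewrite lexI !blb //; [right | left].
Qed.

Lemma supremum_join_closed P x0 A :
  (forall x y, P x -> P y -> P (x `|` y)%O) ->
  finite_set A -> A !=set0 -> (forall a, A a -> P a) -> P (supremum x0 A).
Proof.
move=> PU fA A0 AP.
(* Carrying a witness [m] together with [P m] lets the induction build the bound explicitly. *)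
suff [m Am Pm] : exists2 m, supremums A m & P m by rewrite (supremumE x0 fA A0 Am).
move: fA A0 AP => /finite_seqP[s ->] [x xs].
(* Splitting off the head, and generalising it, keeps every list of the induction nonempty. *)
case: s xs => [//|y s _]; elim: s y => [|z s IH] y AP.
  exists y; first by rewrite set_cons1 supremums1.
  by apply: AP; rewrite /= mem_head.
have [|m [mub mlub] Pm] := IH z.
  by move=> a a_s; apply: AP; rewrite /= inE; apply/orP; right.
exists (y `|` m)%O; last by apply: PU => //; apply: AP; rewrite /= mem_head.
split=> [w /=|b bub].
  rewrite inE => /orP[/eqP->|ws]; first exact: leUl.
  by apply: le_trans (leUr m y); exact: mub.
rewrite leUx bub /= ?mem_head //=.
by apply: mlub => w ws; apply: bub; rewrite /= inE; apply/orP; right.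
Qed.

Lemma infimum_meet_closed P x0 A :
  (forall x y, P x -> P y -> P (x `&` y)%O) ->
  finite_set A -> A !=set0 -> (forall a, A a -> P a) -> P (infimum x0 A).
Proof.
move=> PI fA A0 AP.
suff [m Am Pm] : exists2 m, infimums A m & P m by rewrite (infimumE x0 fA A0 Am).
move: fA A0 AP => /finite_seqP[s ->] [x xs].
case: s xs => [//|y s _]; elim: s y => [|z s IH] y AP.
  exists y; first by rewrite set_cons1 infimums1.
  by apply: AP; rewrite /= mem_head.
have [|m [mlb mglb] Pm] := IH z.
  by move=> a a_s; apply: AP; rewrite /= inE; apply/orP; right.
exists (y `&` m)%O; last by apply: PI => //; apply: AP; rewrite /= mem_head.
split=> [w /=|b blb].
  rewrite inE => /orP[/eqP->|ws]; first exact: leIl.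
  by apply: le_trans (leIr m y) _; exact: mlb.
rewrite lexI blb /= ?mem_head //=.
by apply: mglb => w ws; apply: blb; rewrite /= inE; apply/orP; right.
Qed.

End FiniteBounds.

Section WeakOrdered.
Local Open Scope classical_set_scope.
Context {d : Order.disp_t} {L : latticeType d}.
Implicit Types (R : set (L * L)).

Lemma compatibleP R : compatible R <->
  (forall x y z t, R (x, y) -> R (z, t) -> R (x `&` z, y `&` t)%O) /\
  (forall x y z t, R (x, y) -> R (z, t) -> R (x `|` z, y `|` t)%O).
Proof.
split=> -[RI RU]; split.
- move=> x y z t /mem_set Rxy /mem_set Rzt; apply: set_mem.
  exact: (RI (x, y) (z, t)).
- move=> x y z t /mem_set Rxy /mem_set Rzt; apply: set_mem.
  exact: (RU (x, y) (z, t)).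
- move=> [x y] [z t] /set_mem Rxy /set_mem Rzt; apply: mem_set; exact: RI.
- move=> [x y] [z t] /set_mem Rxy /set_mem Rzt; apply: mem_set; exact: RU.
Qed.

(** The inclusion of the composite in [R] is the right-hand condition; the reverse one uses only
    reflexivity of the order. *)
Lemma relcomp_leqP R : relcomp (relcomp leq_rel R) leq_rel = R <->
  (forall u x y z, (u <= x)%O -> R (x, y) -> (y <= z)%O -> R (u, z)).
Proof.
split=> [RE u x y z ux Rxy yz|RW].
  by rewrite -RE; exists y => //; exists x.
apply/seteqP; split=> [[u z] [y [x ux Rxy] yz]|[x y] Rxy].
  exact: RW ux Rxy yz.
by exists y; [exists x => //; exact: lexx | exact: lexx].
Qed.

Lemma weak_orderedP R : weak_ordered R <->
  [/\ forall u x y z, (u <= x)%O -> R (x, y) -> (y <= z)%O -> R (u, z),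
      forall x y t, R (x, t) -> R (y, t) -> R (x `|` y, t)%O
    & forall x y z, R (z, x) -> R (z, y) -> R (z, x `&` y)%O].
Proof.
split=> -[RW RU RI]; split=> //.
(* The default [t] matches the one in [weak_ordered]. *)
- move=> x y t Rxt Ryt; rewrite -(supremum_set2 t).
  by apply: RU => [||a [->|->]] //; exists x; left.
- move=> x y z Rzx Rzy; rewrite -(infimum_set2 z).
  by apply: RI => [||a [->|->]] //; exists x; left.
- move=> t A fA A0 At.
  by apply: (supremum_join_closed (fun x => R (x, t))) => // x y; exact: RU.
- move=> z A fA A0 Az.
  by apply: (infimum_meet_closed (fun x => R (z, x))) => // x y; exact: RI.
Qed.

End WeakOrdered.

Theorem corollary2p3 (d : Order.disp_t) (L : latticeType d) (R : set (L * L)) :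
  (reflexive_rel R /\ weak_ordered R) <->
  (reflexive_rel R /\ compatible R /\
   relcomp (relcomp leq_rel R) leq_rel = R).
Proof.
rewrite weak_orderedP compatibleP relcomp_leqP.
split=> [[Rxx [RW RU RI]]|[Rxx [[RI RU] RW]]]; do !split=> //.
(* Lower both first coordinates to the meet of [x] and [z]. *)
- move=> x y z t Rxy Rzt; apply: RI.
    exact: RW (leIl x z) Rxy (lexx y).
  exact: RW (leIr z x) Rzt (lexx t).
(* Dually, raise both second coordinates to the join of [y] and [t]. *)
- move=> x y z t Rxy Rzt; apply: RU.
    exact: RW (lexx x) Rxy (leUl y t).
  exact: RW (lexx z) Rzt (leUr t y).
- by move=> x y t Rxt Ryt; rewrite -(joinxx t); exact: RU.
- by move=> x y z Rzx Rzy; rewrite -(meetxx z); exact: RI.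
Qed.
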